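(* Let $\alpha\in(0,1)$ and $\beta\in\left(0,\frac{1-\alpha}{2}\right)$. Then $\kappa_\beta>\kappa_\beta^{\mathbb R}$, where $$\kappa_\beta=\frac{\Gamma(\beta+\alpha/2)\,\Gamma(1-\beta+\alpha/2)}{\Gamma(\beta)\,\Gamma(1-\beta)},\qquad \kappa_\beta^{\mathbb R}=\frac{2^\alpha\,\Gamma((\beta+\alpha)/2)\,\Gamma((1-\beta)/2)}{\Gamma(\beta/2)\,\Gamma((1-\alpha-\beta)/2)}.$$
   Context: $\Gamma$ denotes the Euler gamma function. *)

(* Defs.v *)
From HB Require Import structures.
From mathcomp Require Import all_boot all_order all_algebra.
From mathcomp Require Import all_classical all_reals all_analysis.

Set Implicit Arguments.
Unset Strict Implicit.
Unset Printing Implicit Defensive.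

Import Order.TTheory GRing.Theory Num.Theory.
Import numFieldNormedType.Exports.

Local Open Scope classical_set_scope.
Local Open Scope ring_scope.

(* Euler's integral of the second kind.  It is the gamma function for x > 0
   only: there is no analytic continuation to negative non-integers (for
   x <= 0 the integral diverges, and \int then returns 0). *)
Definition Gamma (R : realType) (x : R) : R :=
  \int[lebesgue_measure]_(t in `]0, +oo[) (t `^ (x - 1) * expR (- t)).

(* For 0 < alpha < 1 and 0 < beta < (1 - alpha) / 2, every argument of Gamma
   in kappa and kappaR is positive. *)
Definition kappa (R : realType) (alpha beta : R) : R :=
  (Gamma (beta + alpha / 2) * Gamma (1 - beta + alpha / 2)) /
  (Gamma beta * Gamma (1 - beta)).

Definition kappaR (R : realType) (alpha beta : R) : R :=
  (2 `^ alpha * Gamma ((beta + alpha) / 2) * Gamma ((1 - beta) / 2)) /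
  (Gamma (beta / 2) * Gamma ((1 - alpha - beta) / 2)).

(* Main.v *)
Require Import Defs.
From mathcomp Require Import all_boot all_order all_algebra.
From mathcomp Require Import all_classical all_reals all_analysis.
From mathcomp Require Import measurable_realfun ring lra.
Set Implicit Arguments.
Unset Strict Implicit.
Unset Printing Implicit Defensive.

Import Order.TTheory GRing.Theory Num.Theory.
Import numFieldNormedType.Exports.
Local Open Scope classical_set_scope.
Local Open Scope ring_scope.

(** Halve the arguments of the four Gamma values in [kappa]: by Legendre's
    duplication formula each Gamma y there becomes, up to a constant and a
    factor 2^y, Gamma (y/2) Gamma ((y+1)/2).  The factors 2^y account exactly
    for the 2^alpha of [kappaR], the constants cancel, and with x = beta/2,
    s = alpha/4 and L = ln o Gamma the claim becomes
<<
      L(x+s) + L(1/2-x-2s) + L(1/2-x+s) + L(1/2+x+s) + L(1-x+s)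
        > L(x+2s) + 2 L(1/2-x) + L(1/2+x) + L(1-x).
>>
    Since x + s < 1/4, the arguments on the left majorize those on the right,
    so the inequality is a consequence of the convexity of L.  It takes three
    moves of a pair of arguments towards each other with their sum fixed
    ([log_comparison]):
<<
      x+s,      1/2+x+s   to   x+2s,     1/2+x
      1/2-x-2s, 1-x+s     to   1/2-x-s,  1-x
      1/2-x-s,  1/2-x+s   to   1/2-x,    1/2-x.
>>
    The last move is strict.  Strictness costs nothing beyond the functional
    equation L(x+1) = L(x) + ln x: shifting the arguments by 1 leaves a weak
    convexity inequality and the gap ln (c^2) - ln (c^2 - h^2) > 0
    ([convex_strict]).

    Only three properties of Gamma are used: positivity, the functional
    equation and log-convexity.  The last one is the pointwise convexity of exp
    integrated with suitable weights ([lnGamma_convex]).  The functional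
    equation comes, together with the convergence of Euler's integral, from a
    fundamental theorem of calculus on the open half-line ([ge0_FTC_oo],
    [Gamma_recurrence_integral]).  Duplication follows from the same three
    properties through the Bohr-Mollerup characterization ([bohr_mollerup],
    [duplication]). *)

(** * Calculus on the open half-line *)

Local Notation mu := lebesgue_measure.

Lemma is_derive_continuous (R : realType) (f : R -> R) (t df : R) :
  is_derive t 1 f df -> {for t, continuous f}.
Proof.
move=> dF; apply: differentiable_continuous; apply/derivable1_diffP.
exact: (@ex_derive _ _ _ _ _ _ _ dF).
Qed.

(** The closed half-lines [1/(n+1), +oo[ exhaust ]0, +oo[, and on each of them
    f is continuous up to the end point, so a possible singularity of f at 0 is
    only seen through the limit l0. *)
Lemma ge0_FTC_oo (R : realType) (f F : R -> R) (l0 l1 : R) :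
  (forall x : R, 0 < x -> 0 <= f x) ->
  (forall x : R, 0 < x -> {for x, continuous f}) ->
  (forall x : R, 0 < x -> is_derive x 1 F (f x)) ->
  F x @[x --> 0^'+] --> l0 -> F x @[x --> +oo] --> l1 ->
  (\int[mu]_(x in `]0%R, +oo[) (f x)%:E = (l1 - l0)%:E)%E.
Proof.
move=> f0 cf dF F0 Fy.
pose A n : set R := `[harmonic n, +oo[%classic.
have AE : (`]0, +oo[%classic : set R) = \bigcup_n A n.
  apply/seteqP; split => x /=; rewrite in_itv/= andbT.
    move=> x0; have xb := archi_boundP (ltW (_ : 0 < x^-1)).
    move: xb; rewrite invr_gt0 => /(_ x0) xb.
    exists (Num.bound x^-1) => //=; rewrite /A/= in_itv/= andbT.
    rewrite invf_ple ?posrE//.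
    by rewrite (le_trans (ltW xb))// ler_nat.
  by move=> [n _]; rewrite /A/= in_itv/= andbT; apply: lt_le_trans;
    rewrite invr_gt0.
have IA n : (\int[mu]_(x in A n) (f x)%:E = (l1 - F (harmonic n))%:E)%E.
  have h0 := @harmonic_gt0 R n.
  have cF x : 0 < x -> {for x, continuous F}.
    by move=> x0; exact: is_derive_continuous (dF x x0).
  rewrite (@ge0_continuous_FTC2y R f F _ l1)//.
  - by move=> x hx; apply: f0; exact: lt_le_trans hx.
  - apply/continuous_within_itvcyP; split.
      move=> x; rewrite in_itv/= andbT => hx; apply: cf; exact: lt_trans hx.
    by apply: cvg_at_right_filter; exact: cf.
  - move=> x hx; exact: (@ex_derive _ _ _ _ _ _ _ (dF x (lt_trans h0 hx))).
  - by apply: cvg_at_right_filter; exact: cF.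
  - move=> x; rewrite in_itv/= andbT => hx; rewrite derive1E.
    exact: (@derive_val _ _ _ _ _ _ _ (dF x (lt_trans h0 hx))).
have mf : measurable_fun (`]0, +oo[%classic : set R) f.
  apply: open_continuous_measurable_fun => // x.
  by rewrite inE/= in_itv/= andbT => /cf.
have := @ge0_nondecreasing_set_cvg_integral _ (measurableTypeR R) R A
  (EFin \o f) (@lebesgue_measure R).
rewrite -AE => /(_ _ _ _ _) cvgI.
apply: (cvg_unique (@ereal_hausdorff R) (cvgI _ _ _ _)).
- apply/nondecreasing_seqP => n; rewrite subsetEset; apply: subset_itvr.
  by rewrite bnd_simp /= lef_pV2 ?posrE// ler_nat.
- by move=> n; exact: measurable_itv.
- move=> n; apply/measurable_EFinP; apply: measurable_funS mf => //.
  by rewrite AE; exact: bigcup_sup.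
- move=> n x; rewrite /A/= in_itv/= andbT => hx; rewrite lee_fin; apply: f0.
  by apply: lt_le_trans hx; rewrite invr_gt0.
rewrite /=; under eq_cvg do rewrite IA.
apply: cvg_EFin; first exact: nearW.
apply: cvgB; first exact: cvg_cst.
move/cvg_at_rightP : F0; apply; split; last exact: cvg_harmonic.
by move=> n; exact: harmonic_gt0.
Qed.

Lemma is_derive_powR_expRN (R : realType) (a t : R) : 0 < t ->
  is_derive t 1 (fun s : R => s `^ a * expR (- s))
    (a * (t `^ (a - 1) * expR (- t)) - t `^ a * expR (- t)).
Proof.
move=> t0; have dp := is_derive1_powR a t0.
have de : is_derive t 1 (fun s : R => expR (- s)) (expR (- t) * -1).
  exact: (@is_derive1_comp _ expR -%R).
apply: is_derive_eq (is_deriveM dp de) _.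
by rewrite /GRing.scale/=; ring.
Qed.

Lemma is_derive_expRN_half (R : realType) (c t : R) :
  is_derive t 1 (fun s : R => - (2 * c) * expR (- (s / 2)))
    (c * expR (- (t / 2))).
Proof.
have d1 : is_derive t 1 (fun s : R => - (s / 2)) (- 2^-1).
  rewrite (_ : (fun s : R => - (s / 2)) = - 2^-1 \*: (id : R -> R)); last first.
    by apply/funext => s /=; rewrite /GRing.scale/=; ring.
  apply: is_derive_eq (is_deriveZ _ (is_derive_id t 1)) _.
  by rewrite /GRing.scale/= mulr1.
have d2 := @is_derive1_comp _ expR _ _ _ _ (is_derive_expR _) d1.
apply: is_derive_eq (is_deriveZ (- (2 * c)) d2) _.
by rewrite /GRing.scale/=; field.
Qed.

Lemma continuous_expRN_half (R : realType) (c : R) :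
  continuous (fun t : R => c * expR (- (t / 2))).
Proof.
move=> t; have := is_derive_continuous (is_derive_expRN_half (- (c / 2)) t).
by rewrite (_ : - (2 * - (c / 2)) = c)//; field.
Qed.

(** With u = t / (2x), the claim is u^x <= exp (x u), that is u <= exp u. *)
Lemma powR_expRN_le (R : realType) (x t : R) : 0 < x -> 0 < t ->
  t `^ x * expR (- t) <= (2 * x) `^ x * expR (- (t / 2)).
Proof.
move=> x0 t0; pose u := t / (2 * x).
have u0 : 0 < u by rewrite divr_gt0 ?mulr_gt0.
have ux : expR (x * u) = expR u `^ x by rewrite mulrC expRM.
have -> : t = (2 * x) * u by rewrite /u; field; rewrite gt_eqF.
have x2 : 0 <= 2 * x by lra.
rewrite powRM ?(ltW u0)// -mulrA ler_wpM2l ?powR_ge0//.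
have -> : expR (- (2 * x * u)) = expR (- (x * u)) * expR (- (x * u)).
  by rewrite -expRD; congr expR; ring.
have -> : 2 * x * u / 2 = x * u by field.
rewrite mulrA ler_piMl ?expR_ge0// expRN ler_pdivrMr ?expR_gt0// mul1r.
rewrite ux; apply: ge0_ler_powR;
  rewrite ?nnegrE ?expR_ge0 ?(ltW u0) ?(ltW x0)//.
have := expR_ge1Dx u; lra.
Qed.

Lemma expRN_half_cvg0 (R : realType) (c : R) :
  c * expR (- (t / 2)) @[t --> 0^'+] --> c.
Proof.
apply: cvg_at_right_filter; have := @continuous_expRN_half R c 0.
by rewrite /prop_for /continuous_at mul0r oppr0 expR0 mulr1.
Qed.

Lemma expRN_half_cvgy (R : realType) (c : R) :
  c * expR (- (t / 2)) @[t --> +oo] --> 0.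
Proof.
rewrite -(mulr0 c); apply: cvgZr.
apply: (@cvg_comp _ _ _ (fun t : R => t / 2) (fun s => expR (- s))).
  by apply: gt0_cvgMly; [rewrite invr_gt0|exact: cvg_id].
exact: cvgr_expR.
Qed.

(** * Finiteness, recurrence and positivity of Gamma *)

Definition Gamma_integrand (R : realType) (x t : R) : R :=
  t `^ (x - 1) * expR (- t).

Lemma Gamma_integrand_ge0 (R : realType) (x t : R) : 0 <= Gamma_integrand x t.
Proof. by rewrite mulr_ge0 ?powR_ge0 ?expR_ge0. Qed.

Lemma measurable_Gamma_integrand (R : realType) (x : R) (D : set R) :
  measurable_fun D (Gamma_integrand x).
Proof.
apply: measurable_funTS; apply: measurable_funM; first exact: measurable_powR.
by apply: measurableT_comp => //; exact: measurable_expR.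
Qed.

Lemma integral_expRN_half (R : realType) (c : R) : 0 <= c ->
  (\int[mu]_(t in `]0%R, +oo[) (c * expR (- (t / 2)))%:E = (2 * c)%:E)%E.
Proof.
move=> c0; pose F (s : R) := - (2 * c) * expR (- (s / 2)).
have f0 (t : R) : 0 < t -> 0 <= c * expR (- (t / 2)).
  by move=> _; rewrite mulr_ge0 ?expR_ge0.
have cf (t : R) : 0 < t ->
    {for t, continuous (fun s : R => c * expR (- (s / 2)))}.
  by move=> _; exact: continuous_expRN_half.
have dF (t : R) : 0 < t -> is_derive t 1 F (c * expR (- (t / 2))).
  by move=> _; exact: is_derive_expRN_half.
have F0 : F t @[t --> 0^'+] --> - (2 * c) by exact: expRN_half_cvg0.
have Fy : F t @[t --> +oo] --> 0 by exact: expRN_half_cvgy.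
by rewrite (ge0_FTC_oo f0 cf dF F0 Fy) sub0r opprK.
Qed.

(** Integration by parts would differentiate t^x exp (-t), whose derivative
    changes sign.  Adding the derivative k(t) = C exp (-t/2) of an explicit
    function makes it nonnegative when k dominates t^x exp (-t), and the
    fundamental theorem for nonnegative functions then gives both conclusions:
    the integral of
      f(t) = x t^(x-1) exp (-t) - t^x exp (-t) + k(t)
    is 2C, the integral of k, so the two remaining terms of f have equal
    integrals; and f >= x t^(x-1) exp (-t) gives finiteness. *)
Lemma Gamma_recurrence_integral (R : realType) (x : R) : 0 < x ->
  (x%:E * \int[mu]_(t in `]0%R, +oo[) (Gamma_integrand x t)%:E =
   \int[mu]_(t in `]0%R, +oo[) (Gamma_integrand (x + 1) t)%:E)%E /\
  (\int[mu]_(t in `]0%R, +oo[) (Gamma_integrand x t)%:E < +oo)%E.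
Proof.
move=> x0; pose C : R := (2 * x) `^ x.
have C0 : 0 <= C by exact: powR_ge0.
pose k (t : R) := C * expR (- (t / 2)).
pose h (t : R) := t `^ x * expR (- t).
pose f t := x * Gamma_integrand x t - h t + k t.
pose F (t : R) := h t + - (2 * C) * expR (- (t / 2)).
have hk t : 0 < t -> h t <= k t by exact: powR_expRN_le.
have h0 t : 0 <= h t by rewrite mulr_ge0 ?powR_ge0 ?expR_ge0.
have G0 := @Gamma_integrand_ge0 R x.
have xG0 t : 0 <= x * Gamma_integrand x t by rewrite mulr_ge0// ltW.
have f0 t : 0 < t -> 0 <= f t.
  by move=> t0; have := hk t t0; have := xG0 t; rewrite /f; lra.
have GE t : Gamma_integrand (x + 1) t = h t by rewrite /Gamma_integrand addrK.
have ch t : 0 < t -> {for t, continuous h}.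
  by move=> t0; apply: is_derive_continuous (is_derive_powR_expRN x t0).
have cG t : 0 < t -> {for t, continuous (Gamma_integrand x)}.
  by move=> t0; apply: is_derive_continuous (is_derive_powR_expRN (x - 1) t0).
have ck t : {for t, continuous k}.
  exact: continuous_expRN_half.
have mh : measurable_fun (`]0, +oo[%classic : set R) h.
  rewrite (_ : h = Gamma_integrand (x + 1)); last by apply/funext => t.
  exact: measurable_Gamma_integrand.
have mG := @measurable_Gamma_integrand R x (`]0, +oo[%classic : set R).
have mk : measurable_fun (`]0, +oo[%classic : set R) k.
  by apply: open_continuous_measurable_fun => // t _; exact: ck.
have cf t : 0 < t -> {for t, continuous f}.
  pose xG t := x * Gamma_integrand x t.
  move=> t0; apply: (@continuousD _ _ _ (fun t => xG t - h t) k) => //.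
  apply: (@continuousB _ _ _ xG h); last exact: ch.
  by apply: (@continuousM _ _ (cst x)); [exact: cst_continuous|exact: cG].
have mf : measurable_fun (`]0, +oo[%classic : set R) f.
  apply: open_continuous_measurable_fun => // t.
  by rewrite inE/= in_itv/= andbT => /cf.
have If : (\int[mu]_(t in `]0%R, +oo[) (f t)%:E = (2 * C)%:E)%E.
  have dF (t : R) : 0 < t -> is_derive t 1 F (f t).
    move=> t0; have dh := is_derive_powR_expRN x t0.
    exact: is_deriveD dh (is_derive_expRN_half C t).
  have Fy : F t @[t --> +oo] --> 0.
    rewrite /F -[X in _ --> X]addr0; apply: cvgD; last exact: expRN_half_cvgy.
    apply: (@squeeze_cvgr _ _ _ _ (cst 0) k); last 2 first.
    - exact: cvg_cst.
    - exact: expRN_half_cvgy.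
    by near=> t; rewrite h0/= hk//; near: t; exact: nbhs_pinfty_gt.
  have F0 : F t @[t --> 0^'+] --> - (2 * C).
    rewrite /F -[X in _ --> X]add0r; apply: cvgD; last exact: expRN_half_cvg0.
    rewrite /h -[X in _ --> X](mul0r (expR (- 0))).
    apply: cvgM; first exact: powR_cvg0.
    apply: cvg_at_right_filter; apply: (@continuous_comp _ _ _ -%R expR).
      exact: opp_continuous.
    exact: continuous_expR.
  by rewrite (ge0_FTC_oo f0 cf dF F0 Fy) sub0r opprK.
have Ik := integral_expRN_half C0.
have xI : (\int[mu]_(t in `]0%R, +oo[) (x * Gamma_integrand x t)%:E =
   x%:E * \int[mu]_(t in `]0%R, +oo[) (Gamma_integrand x t)%:E)%E.
  under eq_integral do rewrite EFinM.
  rewrite ge0_integralZl_EFin//; last exact: ltW.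
    by move=> t _; rewrite lee_fin.
  exact/measurable_EFinP.
split.
  under [in RHS]eq_integral do rewrite GE.
  have : (\int[mu]_(t in `]0%R, +oo[)
            ((x * Gamma_integrand x t)%:E + (k t)%:E) =
          \int[mu]_(t in `]0%R, +oo[) ((f t)%:E + (h t)%:E))%E.
    by apply: eq_integral => t _; rewrite -!EFinD; congr EFin; rewrite /f; ring.
  rewrite ge0_integralD//=; last 4 first.
  - by move=> t _; rewrite lee_fin.
  - by apply/measurable_EFinP; apply: measurable_funM.
  - by move=> t _; rewrite lee_fin mulr_ge0 ?expR_ge0.
  - exact/measurable_EFinP.
  rewrite ge0_integralD//=; last 4 first.
  - by move=> t; rewrite in_itv/= andbT lee_fin; exact: f0.
  - exact/measurable_EFinP.
  - by move=> t _; rewrite lee_fin.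
  - exact/measurable_EFinP.
  rewrite If Ik xI [RHS]addeC => /(congr1 (fun z => z - (2 * C)%:E)%E).
  by rewrite !addeK.
have : (\int[mu]_(t in `]0%R, +oo[) (x * Gamma_integrand x t)%:E <=
    (2 * C)%:E)%E.
  rewrite -If; apply: ge0_le_integral => //=.
  - by move=> t _; rewrite lee_fin.
  - by apply/measurable_EFinP; apply: measurable_funM.
  - exact/measurable_EFinP.
  - move=> t; rewrite in_itv/= andbT lee_fin => t0.
    by have := hk t t0; rewrite /f; lra.
rewrite xI => le.
have : (\int[mu]_(t in `]0%R, +oo[) (Gamma_integrand x t)%:E <=
    (x^-1)%:E * (2 * C)%:E)%E.
  by rewrite lee_pdivlMl.
by move=> /le_lt_trans; apply; rewrite -EFinM ltry.
Unshelve. all: by end_near. Qed.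

Lemma Gamma_integralE (R : realType) (x : R) : 0 < x ->
  (\int[mu]_(t in `]0%R, +oo[) (Gamma_integrand x t)%:E = (Gamma x)%:E)%E.
Proof.
move=> x0; rewrite /Gamma /Rintegral fineK// ge0_fin_numE.
  by have [] := Gamma_recurrence_integral x0.
by apply: integral_ge0 => t _; rewrite lee_fin Gamma_integrand_ge0.
Qed.

Lemma Gamma_recurrence (R : realType) (x : R) : 0 < x ->
  Gamma (x + 1) = x * Gamma x.
Proof.
move=> x0; have [+ _] := Gamma_recurrence_integral x0.
rewrite !Gamma_integralE//; last by rewrite addr_gt0.
by rewrite -EFinM => -[].
Qed.

(** On [1, 2] the integrand is at least exp (-2) / 2. *)
Lemma Gamma_gt0 (R : realType) (x : R) : 0 < x -> 0 < Gamma x.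
Proof.
move=> x0; pose m : R := expR (- 2) / 2.
have m0 : 0 < m by rewrite divr_gt0 ?expR_gt0.
suff : m <= Gamma x by exact: lt_le_trans.
rewrite -lee_fin -Gamma_integralE//.
have -> : (m%:E = \int[@lebesgue_measure R]_(t in `[1%R, 2%R]) (cst m%:E) t)%E.
  rewrite integral_cst//= lebesgue_measure_itv/= lte_fin ltr1n -EFinB -EFinM.
  by congr EFin; ring.
apply: (@le_trans _ _
  (\int[@lebesgue_measure R]_(t in `[1%R, 2%R]) (Gamma_integrand x t)%:E)%E).
  apply: ge0_le_integral => //=.
  - by move=> t _; rewrite lee_fin ltW.
  - by apply/measurable_EFinP; exact: measurable_Gamma_integrand.
  - move=> t; rewrite in_itv/= => /andP[t1 t2].
    rewrite lee_fin /m /Gamma_integrand.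
    rewrite mulrC ler_pM ?expR_ge0 ?invr_ge0// ?ler_expR ?lerN2//.
    have t0 : 0 < t by lra.
    rewrite powRB ?(gt_eqF t0) ?implybT// powRr1 ?(ltW t0)//.
    have tx : 1 <= t `^ x.
      by rewrite -[leLHS](powRr0 t); apply: ler_powR; rewrite // ltW.
    rewrite ler_pdivlMr//; lra.
apply: ge0_subset_integral => //=.
- by apply/measurable_EFinP; exact: measurable_Gamma_integrand.
- by move=> t _; rewrite lee_fin Gamma_integrand_ge0.
- by move=> t /=; rewrite !in_itv/= => /andP[t1 _]; rewrite andbT; lra.
Qed.

(** * Convex solutions of the logarithmic factorial equation *)

Definition convex_on_pos (R : realType) (f : R -> R) := forall t x y : R,
  0 <= t <= 1 -> 0 < x -> 0 < y ->
  f (t * x + (1 - t) * y) <= t * f x + (1 - t) * f y.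

Definition log_factorial_eq (R : realType) (f : R -> R) := forall x : R,
  0 < x -> f (x + 1) = f x + ln x.

(** For a convex function, moving two arguments apart with their sum fixed
    increases the sum of the values. *)
Lemma convex_spread (R : realType) (f : R -> R) (p q u v : R) :
  convex_on_pos f -> 0 < p -> p <= u -> u <= q -> u + v = p + q ->
  f u + f v <= f p + f q.
Proof.
move=> cf p0 pu uq uv.
have [pq|qp] := ltP p q; last first.
  have -> : u = p by lra.
  have -> : v = q by lra.
  by [].
have qp0 : q - p != 0 by rewrite subr_eq0 gt_eqF.
pose t := (q - u) / (q - p).
have t01 : 0 <= t <= 1.
  by rewrite /t divr_ge0 ?ler_pdivrMr; lra.
have q0 : 0 < q by lra.
have t01' : 0 <= 1 - t <= 1 by lra.
have := cf t p q t01 p0 q0.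
have := cf (1 - t) p q t01' p0 q0.
have -> : t * p + (1 - t) * q = u by rewrite /t; field.
have -> : (1 - t) * p + (1 - (1 - t)) * q = v.
  have -> : v = p + q - u by lra.
  by rewrite /t; field.
lra.
Qed.

(** Shifting by 1 turns the sum at c - h, c + h into the one at c + 1 - h,
    c + 1 + h, to which weak convexity applies; the shift itself contributes the
    strict inequality (c - h)(c + h) < c^2. *)
Lemma convex_strict (R : realType) (f : R -> R) (c h : R) :
  convex_on_pos f -> log_factorial_eq f -> 0 < h -> h < c ->
  2 * f c < f (c - h) + f (c + h).
Proof.
move=> cf ff h0 hc.
have := ff (c - h) ltac:(lra); have := ff (c + h) ltac:(lra).
have := ff c ltac:(lra).
have lnlt : ln (c - h) + ln (c + h) < 2 * ln c.
  rewrite -lnM ?posrE; [|lra|lra].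
  rewrite mulr_natl -lnXn; last lra.
  by rewrite ltr_ln ?posrE; nra.
have := @convex_spread R f (c - h + 1) (c + h + 1) (c + 1) (c + 1) cf.
move=> /(_ ltac:(lra) ltac:(lra) ltac:(lra) ltac:(lra)).
lra.
Qed.

(** The difference f - g is 1-periodic and vanishes at the positive integers.
    Convexity on [N, N+1] bounds f (N + x) from above in terms of f N, and on
    [N + x, N + x + 1] it bounds g (N + x) from below in terms of g N; the two
    bounds differ by (1 - x) (ln (N + x) - ln N), at most 1/N. *)
Lemma bohr_mollerup_le (R : realType) (f g : R -> R) (x : R) :
  convex_on_pos f -> log_factorial_eq f ->
  convex_on_pos g -> log_factorial_eq g ->
  f 1 = g 1 -> 0 < x <= 1 -> f x <= g x.
Proof.
move=> cf ff cg fg fg1 x01.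
have fgn n : f n.+1%:R = g n.+1%:R.
  elim: n => [//|n IH]; have n0 : (0 : R) < n.+1%:R by rewrite ltr0Sn.
  by rewrite -[n.+2%:R]natr1 ff// fg// IH.
have fgx n : f (n%:R + x) - g (n%:R + x) = f x - g x.
  elim: n => [|n IH]; first by rewrite add0r.
  have n0 : (0 : R) <= n%:R by rewrite ler0n.
  by rewrite -natr1 addrAC ff ?fg; lra.
have bnd n : f x - g x <= n.+1%:R^-1.
  rewrite -(fgx n.+1).
  set N : R := n.+1%:R; have N1 : 1 <= N by rewrite /N ler1n.
  have fgN : f N = g N := fgn n.
  have N0 : 0 < N by lra.
  have Nx0 : 0 < N + x by lra.
  have := cf (1 - x) N (N + 1) ltac:(lra) N0 ltac:(lra).
  have -> : (1 - x) * N + (1 - (1 - x)) * (N + 1) = N + x by ring.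
  rewrite (ff N)// => h1.
  have := cg x (N + x) (N + x + 1) ltac:(lra) Nx0 ltac:(lra).
  have -> : x * (N + x) + (1 - x) * (N + x + 1) = N + 1 by ring.
  rewrite (fg N)// (fg (N + x))// => h2.
  have xN0 : 0 <= x / N by rewrite divr_ge0// ltW//; lra.
  have lnNx : ln (N + x) - ln N <= x / N.
    rewrite -ln_div ?posrE//.
    have -> : (N + x) / N = 1 + x / N by field; rewrite gt_eqF.
    by apply: le_ln1Dx; rewrite (lt_le_trans _ xN0)// ltrN10.
  have xN : x / N <= N^-1 by rewrite ler_piMl ?invr_ge0//; lra.
  have : (1 - x) * (ln (N + x) - ln N) <= x / N.
    apply: (@le_trans _ _ ((1 - x) * (x / N))).
      by apply: ler_wpM2l => //; lra.
    by apply: ler_piMl => //; lra.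
  by clearbody N; lra.
rewrite -subr_le0 leNgt; apply/negP => d0.
have := archi_boundP (ltW (_ : 0 < (f x - g x)^-1)).
rewrite invr_gt0 => /(_ d0); set m := Num.bound _ => hm.
have m0 : (0 < m)%N.
  by rewrite -(ltr0n R); apply: lt_trans hm; rewrite invr_gt0.
have := bnd m.-1; rewrite prednK// leNgt => /negP; apply.
by rewrite invf_plt ?posrE ?ltr0n.
Qed.

(** Periodicity of the difference carries [bohr_mollerup_le] from ]0, 1] to the
    half-line. *)
Lemma bohr_mollerup (R : realType) (f g : R -> R) (x : R) :
  convex_on_pos f -> log_factorial_eq f ->
  convex_on_pos g -> log_factorial_eq g ->
  0 < x -> f x - f 1 = g x - g 1.
Proof.
move=> cf ff cg fg.
pose h y := g y - g 1 + f 1.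
have ch : convex_on_pos h.
  by move=> t a b t01 a0 b0; have := cg t a b t01 a0 b0; rewrite /h; nra.
have fh : log_factorial_eq h by move=> y y0; rewrite /h fg//; ring.
have fh1 : f 1 = h 1 by rewrite /h; ring.
suff fhE n y : 0 < y <= n.+1%:R -> f y = h y.
  move=> x0; have xn := archi_boundP (ltW x0).
  rewrite (fhE (Num.bound x) x) /h; first by ring.
  by rewrite x0/= (le_trans (ltW xn))// ler_nat.
elim: n y => [|n IH] y y0n.
  by apply/eqP; rewrite eq_le !bohr_mollerup_le.
have [y1|y1] := leP y 1.
  by apply/eqP; rewrite eq_le !bohr_mollerup_le//; lra.
rewrite -[y](subrK 1) ff ?fh; [|lra|lra].
by rewrite IH//; move: y0n; rewrite -natr1; lra.
Qed.

(** The function y ln 2 + f (y/2) + f ((y+1)/2) is convex and satisfies the same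
    functional equation as f, so it differs from f by a constant. *)
Lemma duplication (R : realType) (f : R -> R) (x : R) :
  convex_on_pos f -> log_factorial_eq f -> 0 < x ->
  f x - f 1 = x * ln 2 + f (x / 2) + f ((x + 1) / 2) - (ln 2 + f (1 / 2) + f 1).
Proof.
move=> cf ff x0.
pose g y := y * ln 2 + f (y / 2) + f ((y + 1) / 2).
rewrite (@bohr_mollerup R f g)//.
- by rewrite /g (_ : (1 + 1 : R) / 2 = 1) ?mul1r//; field.
- move=> t a b t01 a0 b0; rewrite /g.
  have := cf t (a / 2) (b / 2) t01 ltac:(lra) ltac:(lra).
  have := cf t ((a + 1) / 2) ((b + 1) / 2) t01 ltac:(lra) ltac:(lra).
  have -> : t * (a / 2) + (1 - t) * (b / 2) = (t * a + (1 - t) * b) / 2.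
    by field.
  have -> : t * ((a + 1) / 2) + (1 - t) * ((b + 1) / 2) =
            (t * a + (1 - t) * b + 1) / 2 by field.
  lra.
- move=> y y0; rewrite /g.
  have -> : (y + 1 + 1) / 2 = y / 2 + 1 by field.
  rewrite ff ?divr_gt0// ln_div ?posrE//; ring.
Qed.

(** Duplication at the four arguments on the right-hand side doubles the number
    of terms; the two weak moves and the strict one then compare them with the
    left-hand side. *)
Lemma log_comparison (R : realType) (f : R -> R) (alpha beta : R) :
  convex_on_pos f -> log_factorial_eq f ->
  0 < alpha < 1 -> 0 < beta < (1 - alpha) / 2 ->
  alpha * ln 2 + f ((beta + alpha) / 2) + f ((1 - beta) / 2)
    - (f (beta / 2) + f ((1 - alpha - beta) / 2)) <
  f (beta + alpha / 2) + f (1 - beta + alpha / 2) - (f beta + f (1 - beta)).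
Proof.
move=> cf ff a01 b01.
have := @duplication R f beta cf ff ltac:(lra).
have := @duplication R f (1 - beta) cf ff ltac:(lra).
have := @duplication R f (beta + alpha / 2) cf ff ltac:(lra).
have := @duplication R f (1 - beta + alpha / 2) cf ff ltac:(lra).
have := @convex_spread R f ((beta + alpha / 2) / 2) ((beta + alpha / 2 + 1) / 2)
  ((beta + alpha) / 2) ((beta + 1) / 2) cf
  ltac:(lra) ltac:(lra) ltac:(lra) ltac:(lra).
have := @convex_spread R f ((1 - alpha - beta) / 2)
  ((1 - beta + alpha / 2 + 1) / 2)
  ((1 - beta - alpha / 2) / 2) ((1 - beta + 1) / 2) cf
  ltac:(lra) ltac:(lra) ltac:(lra) ltac:(lra).
have := @convex_strict R f ((1 - beta) / 2) (alpha / 4) cf ff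
  ltac:(lra) ltac:(lra).
have -> : (1 - beta) / 2 - alpha / 4 = (1 - beta - alpha / 2) / 2 by field.
have -> : (1 - beta) / 2 + alpha / 4 = (1 - beta + alpha / 2) / 2 by field.
lra.
Qed.

(** * Log-convexity of Gamma and the comparison *)

Lemma lnGamma_recurrence (R : realType) :
  log_factorial_eq (fun x : R => ln (Gamma x)).
Proof.
by move=> x x0; rewrite Gamma_recurrence// lnM ?posrE ?Gamma_gt0// addrC.
Qed.

Lemma Gamma_le_comb (R : realType) (x y z a b : R) :
  0 < x -> 0 < y -> 0 < z -> 0 <= a -> 0 <= b ->
  (forall t, 0 < t -> Gamma_integrand z t <=
    a * Gamma_integrand x t + b * Gamma_integrand y t) ->
  Gamma z <= a * Gamma x + b * Gamma y.
Proof.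
move=> x0 y0 z0 a0 b0 pw.
have mG u (c : R) : measurable_fun (`]0, +oo[%classic : set R)
    (fun t => (c * Gamma_integrand u t)%:E).
  apply/measurable_EFinP; apply: measurable_funM => //.
  exact: measurable_Gamma_integrand.
have G0 u (c t : R) : 0 <= c -> (0 <= (c * Gamma_integrand u t)%:E)%E.
  by move=> c0; rewrite lee_fin mulr_ge0 ?Gamma_integrand_ge0.
have scale u (c : R) : 0 < u -> 0 <= c ->
    (\int[mu]_(t in `]0%R, +oo[) (c * Gamma_integrand u t)%:E =
     (c * Gamma u)%:E)%E.
  move=> u0 c0; rewrite EFinM -(Gamma_integralE u0) -ge0_integralZl_EFin//.
    by move=> t _; rewrite lee_fin Gamma_integrand_ge0.
  by apply/measurable_EFinP; exact: measurable_Gamma_integrand.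
rewrite -lee_fin EFinD -(scale x a x0 a0) -(scale y b y0 b0).
rewrite -(Gamma_integralE z0).
rewrite -ge0_integralD//; last 4 first.
- by move=> t _; exact: G0.
- exact: mG.
- by move=> t _; exact: G0.
- exact: mG.
apply: ge0_le_integral => //=.
- by move=> t _; rewrite lee_fin Gamma_integrand_ge0.
- by apply/measurable_EFinP; exact: measurable_Gamma_integrand.
- by apply: emeasurable_funD; exact: mG.
- by move=> t; rewrite in_itv/= andbT => t0; rewrite -EFinD lee_fin pw.
Qed.

Lemma Gamma_integrandE (R : realType) (x t : R) : 0 < t ->
  Gamma_integrand x t = expR ((x - 1) * ln t - t).
Proof. by move=> t0; rewrite /Gamma_integrand /powR gt_eqF// -expRD. Qed.

(** The weights below normalize the integrands at x and y by Gamma x = exp p and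
    Gamma y = exp q, up to the common factor exp w.  The pointwise convexity of
    exp, applied to the logarithms of the normalized integrands, then integrates
    to Gamma z <= s exp w + (1 - s) exp w = exp w at z = s x + (1 - s) y. *)
Lemma lnGamma_convex (R : realType) : convex_on_pos (fun x : R => ln (Gamma x)).
Proof.
move=> s x y s01 x0 y0 /=.
have z0 : 0 < s * x + (1 - s) * y by nra.
have [/andP[s0 s1] s1'] : 0 <= s <= 1 /\ 0 <= 1 - s by split; lra.
have gz := Gamma_gt0 z0.
have [p gx] : exists p, Gamma x = expR p.
  by exists (ln (Gamma x)); rewrite lnK ?posrE ?Gamma_gt0.
have [q gy] : exists q, Gamma y = expR q.
  by exists (ln (Gamma y)); rewrite lnK ?posrE ?Gamma_gt0.
rewrite gx gy !expRK -ler_expR lnK ?posrE//.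
have [w wE] : exists w, w = s * p + (1 - s) * q by eexists.
have -> : expR (s * p + (1 - s) * q) =
    s * expR (w - p) * Gamma x + (1 - s) * expR (w - q) * Gamma y.
  by rewrite gx gy -!mulrA -!expRD !subrK -wE; ring.
apply: Gamma_le_comb; rewrite ?mulr_ge0 ?expR_ge0// => t t0.
rewrite !Gamma_integrandE// -!mulrA -!expRD.
apply: le_trans (convex_expR (Itv01 s0 s1) _ _).
rewrite convRE /= /unstable.onem.
by rewrite ler_expR wE; clear gx gy gz; lra.
Qed.

Theorem mainTheorem4 (R : realType) (alpha beta : R)
    (halpha : 0 < alpha < 1) (hbeta : 0 < beta < (1 - alpha) / 2) :
  kappa alpha beta > kappaR alpha beta.
Proof.
have := log_comparison (@lnGamma_convex R) (@lnGamma_recurrence R) halpha hbeta.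
have a1 : 0 < beta + alpha / 2 by lra.
have a2 : 0 < 1 - beta + alpha / 2 by lra.
have a3 : 0 < beta by lra.
have a4 : 0 < 1 - beta by lra.
have a5 : 0 < (beta + alpha) / 2 by lra.
have a6 : 0 < (1 - beta) / 2 by lra.
have a7 : 0 < beta / 2 by lra.
have a8 : 0 < (1 - alpha - beta) / 2 by lra.
rewrite /kappa /kappaR.
move: (Gamma_gt0 a1) (Gamma_gt0 a2) (Gamma_gt0 a3) (Gamma_gt0 a4)
  (Gamma_gt0 a5) (Gamma_gt0 a6) (Gamma_gt0 a7) (Gamma_gt0 a8).
move: (Gamma _) (Gamma _) (Gamma _) (Gamma _) (Gamma _) (Gamma _) (Gamma _)
  (Gamma _) => G1 G2 G3 G4 G5 G6 G7 G8 g1 g2 g3 g4 g5 g6 g7 g8 logs.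
have p2 : 0 < (2 : R) `^ alpha by rewrite powR_gt0.
rewrite -ltr_ln ?posrE ?divr_gt0 ?mulr_gt0//.
by rewrite !ln_div ?lnM ?posrE ?mulr_gt0// ln_powR.
Qed.
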